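(* Let $0<\alpha<\frac n2$, let $t\ge0$ be an integer, $j\in\mathbb{Z}$, $k\in\mathbb{Z}^n$, and let $$g^t_{j,k}(x)=\sum_{(\epsilon,s,u)\in G_{t,n}}g^\epsilon_{j+s,2^sk+u}\Phi^\epsilon_{j+s,2^sk+u}(x)$$ with real coefficients and $\|g^t_{j,k}\|_{P^\alpha}>0$. (i) There exists a function $Sf^t_{j,k}(x)=\sum_{(\epsilon,s,u)\in G_{t,n}}S^t_jf^\epsilon_{j+s,2^sk+u}\,\Phi^\epsilon_{j+s,2^sk+u}(x)$ (with real coefficients $S^t_jf^\epsilon_{j+s,2^sk+u}$) with $\|Sf^t_{j,k}\|_{Q^0_\alpha}\le1$ such that $$\max_{\|f\|_{Q^0_\alpha}\le1}\tau_{f,g^t_{j,k}}=\sum_{(\epsilon,s,u)\in G_{t,n}}S^t_jf^\epsilon_{j+s,2^sk+u}\cdot g^\epsilon_{j+s,2^sk+u}.$$ (ii) There exists a positive number $P^t_jg^t_{j,k}$, determined by the absolute values of the wavelet coefficients of $g^t_{j,k}$, such that $$P^t_jg^t_{j,k}=\|g^t_{j,k}\|_{P^\alpha}=\max_{\|f\|_{Q^0_\alpha}\le1}\tau_{f,g^t_{j,k}}=\tau_{Sf^t_{j,k},\,g^t_{j,k}}.$$ (iii) There exists a sequence $\{Q^t_jg^\epsilon_{j,k}\}_{\epsilon\in E_n}$ such that $\sum_{\epsilon\in E_n}Q^t_jg^\epsilon_{j,k}\Phi^\epsilon_{j,k}(x)$ has the same norm in $P^\alpha(\mathbb{R}^n)$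 as $g^t_{j,k}$ does.
   Context: $E_n=\{0,1\}^n\setminus\{0\}$; $\Lambda_n=\{(\epsilon,j,k):\epsilon\in E_n,j\in\mathbb{Z},k\in\mathbb{Z}^n\}$; for integers $s\ge0$, $\Lambda_{s,n}=\{0,1,\dots,2^s-1\}^n$; $G_{t,n}=\{(\epsilon,s,v):\epsilon\in E_n,\ 0\le s\le t,\ v\in\Lambda_{s,n}\}$. $\{\Phi^\epsilon_{j,k}\}_{(\epsilon,j,k)\in\Lambda_n}$, $\Phi^\epsilon_{j,k}(x)=2^{jn/2}\Phi^\epsilon(2^jx-k)$, is an orthonormal basis of $L^2(\mathbb{R}^n)$ of real-valued tensor product wavelets, either classical Meyer wavelets or compactly supported Daubechies wavelets of class $C^m$ with vanishing moments up to order $m-1$, $m>8n$. Functions are real-valued and identified with their coefficient sequences, $f=\sum_{(\epsilon,j,k)\in\Lambda_n}f^\epsilon_{j,k}\Phi^\epsilon_{j,k}$. The pairing is $\tau_{f,g}=\langle f,g\rangle=\sum_{(\epsilon,j,k)\in\Lambda_n}f^\epsilon_{j,k}g^\epsilon_{j,k}$. Dyadic cubes: $Q_{j,k}=\prod_{i=1}^n[2^{-j}k_i,2^{-j}(k_i+1)]$, $\Omega$ the set of all of them. For $Q\in\Omega$ let $C_{\alpha,Q}f=|Q|^{\frac\alpha n-\frac12}\big(\sum_{\epsilon\in E_n,\,Q_{j,k}\subset Q}2^{2j\alpha}|f^\epsilon_{j,k}|^2\big)^{1/2}$. $Q^0_\alpha(\mathbb{R}^n)$ is the space of $f$ with $\|f\|_{Q^0_\alpha}=\sup_{Q\in\Omega}C_{\alpha,Q}f<\infty$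 and with $C_{\alpha,Q}f\to0$ both as $|Q|\to0$ and as $|Q|\to\infty$ ($Q\in\Omega$). $P^\alpha(\mathbb{R}^n)$ is the dual space of $Q^0_\alpha(\mathbb{R}^n)$ under the pairing $\tau$, with norm $\|g\|_{P^\alpha}=\sup_{\|f\|_{Q^0_\alpha}\le1}\tau_{f,g}$. (It coincides with the space of $\ell^1$-combinations of $(\alpha,2)$-wavelet atoms, i.e. distributions $a=\sum_{\epsilon\in E_n,\,Q_{j,k}\subset Q}a^\epsilon_{j,k}\Phi^\epsilon_{j,k}$ with $\big(\sum2^{-2j\alpha}|a^\epsilon_{j,k}|^2\big)^{1/2}\le|Q|^{\frac\alpha n-\frac12}$, $Q\in\Omega$.) *)

(* Defs.v *)
From HB Require Import structures.
From mathcomp Require Import all_boot all_order all_algebra.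
From mathcomp Require Import all_classical all_reals all_analysis.

Set Implicit Arguments.
Unset Strict Implicit.
Unset Printing Implicit Defensive.

Import Order.TTheory GRing.Theory Num.Theory.
Local Open Scope classical_set_scope.
Local Open Scope ring_scope.

(* A real-valued function (or distribution) f = \sum_l f_l Phi_l is identified
   with its sequence of wavelet coefficients l |-> f_l; all the norms and the
   pairing below depend on these coefficients only, so that the same
   definitions serve the Meyer and the Daubechies bases. *)

Definition E (n : nat) : finType :=
  {e : {ffun 'I_n -> bool} | e != [ffun=> false]}.

Definition Lam (n : nat) : choiceType := (E n * int * {ffun 'I_n -> int})%type.

Definition scale n (l : Lam n) : int := l.1.2.

Definition pos n (l : Lam n) : {ffun 'I_n -> int} := l.2.

(* Elements (e, s, v) with 0 <= s <= t and v in {0, ..., 2 ^ s - 1} ^ n. *)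
Definition G (t n : nat) : finType :=
  (E n * {s : 'I_t.+1 & {ffun 'I_n -> 'I_(2 ^ s)}})%type.

(* (e, s, u) |-> (e, j + s, 2 ^ s k + u) *)
Definition node t n (j : int) (k : {ffun 'I_n -> int}) (x : G t n) : Lam n :=
  (x.1, j + (tag x.2 : nat)%:Z,
   [ffun i => 2 ^+ (tag x.2 : nat) * k i + (tagged x.2 i : nat)%:Z]).

Section Spaces.
Variables (R : realType) (n : nat).

(* The function Phi_l, as a sequence of coefficients. *)
Definition wavelet (l : Lam n) : Lam n -> R := fun l' => (l' == l)%:R.

(* \sum_((e, s, u) in G t n) g_(e, j+s, 2^s k+u) Phi_(e, j+s, 2^s k+u) *)
Definition tree_fun (t : nat) (j : int) (k : {ffun 'I_n -> int})
    (g : Lam n -> R) : Lam n -> R :=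
  \sum_(x : G t n) g (node j k x) *: wavelet (node j k x).

Definition cube (j : int) (k : {ffun 'I_n -> int}) : set 'rV[R]_n :=
  [set x | forall i, 2 ^ (- j) * (k i)%:~R <= x ord0 i
                     <= 2 ^ (- j) * (k i + 1)%:~R].

(* Lebesgue measure of cube j k *)
Definition cube_vol (j : int) : R := (2 ^ (- j)) ^+ n.

Definition C (alpha : R) (f : Lam n -> R) (j : int) (k : {ffun 'I_n -> int})
    : \bar R :=
  ((cube_vol j `^ (alpha / n%:R - 2^-1))%:E *
   sqrte (\esum_(l in [set l | cube (scale l) (pos l) `<=` cube j k])
            (2 `^ (2 * (scale l)%:~R * alpha) * `|f l| ^+ 2)%:E))%E.

Definition Q0_norm (alpha : R) (f : Lam n -> R) : \bar R :=
  ereal_sup [set C alpha f q.1 q.2 | q in [set: int * {ffun 'I_n -> int}]].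

Definition Q0 (alpha : R) : set (Lam n -> R) :=
  [set f | [/\ (Q0_norm alpha f < +oo)%E,
     forall eps : R, 0 < eps -> exists2 d : R, 0 < d &
       forall j k, cube_vol j < d -> (C alpha f j k < eps%:E)%E
   & forall eps : R, 0 < eps -> exists M : R,
       forall j k, M < cube_vol j -> (C alpha f j k < eps%:E)%E]].

Definition Q0_ball (alpha : R) : set (Lam n -> R) :=
  [set f | Q0 alpha f /\ (Q0_norm alpha f <= 1)%E].

Definition pairing_summable (f g : Lam n -> R) : Prop :=
  summable [set: Lam n] (fun l => (f l * g l)%:E).

(* The sum over Lam n of f l * g l; it is meaningful when
   pairing_summable f g holds. *)
Definition tau (f g : Lam n -> R) : R :=
  fine (\esum_(l in [set: Lam n]) (Num.max (f l * g l) 0)%:E) -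
  fine (\esum_(l in [set: Lam n]) (Num.max (- (f l * g l)) 0)%:E).

Definition P_norm (alpha : R) (g : Lam n -> R) : \bar R :=
  ereal_sup [set (tau f g)%:E | f in Q0_ball alpha].

(* The dual of Q0 under tau.  Convergence of the pairing is required to be
   absolute, which is no restriction: Q0 is stable under changes of signs of
   the coefficients. *)
Definition P_space (alpha : R) : set (Lam n -> R) :=
  [set g | (forall f, Q0 alpha f -> pairing_summable f g) /\
           (P_norm alpha g < +oo)%E].

Definition is_max (A : set R) (m : R) : Prop := A m /\ ubound A m.

End Spaces.

(* Main.v *)
Require Import Defs.
From HB Require Import structures.
From mathcomp Require Import all_boot all_order all_algebra.
From mathcomp Require Import all_classical all_reals all_analysis.
From mathcomp Require Import lra.
Set Implicit Arguments.
Unset Strict Implicit.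
Unset Printing Implicit Defensive.
Import Order.TTheory GRing.Theory Num.Theory.
Local Open Scope classical_set_scope.
Local Open Scope ring_scope.

(** Since alpha < n / 2, the weight |Q|^(alpha/n - 1/2) decays as |Q| grows, so
    finitely supported sequences lie in Q^0_alpha. As C_(alpha,Q) only sees
    absolute values and is monotone in them, restricting f to the finite support
    of g keeps f in the unit ball and does not change the pairing with g. The
    supremum is therefore taken over a closed bounded subset of a
    finite-dimensional space, hence attained. Changing the signs of f turns g
    into |g|, so the P^alpha norm is a function of |g|, and for (iii) a suitable
    multiple of a single wavelet at (j, k) has the required norm. *)

(** * Elementary facts on the pairing and on volumes of dyadic cubes *)

Lemma eq_tau (R : realType) n (f g f' g' : Lam n -> R) :
  (forall l, f' l * g' l = f l * g l) -> tau f' g' = tau f g.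
Proof.
by move=> e; rewrite /tau; under eq_esum do rewrite e;
   under [X in _ - fine X]eq_esum do rewrite e.
Qed.

Lemma cube_vol_gt0 (R : realType) n (j : int) : 0 < cube_vol R n j.
Proof. by rewrite /cube_vol exprn_gt0// exprz_gt0. Qed.

Lemma cube_vol_anti (R : realType) n (i j : int) :
  i <= j -> cube_vol R n j <= cube_vol R n i.
Proof.
move=> ij; rewrite /cube_vol lerXn2r// ?nnegrE ?exprz_ge0//.
by rewrite ler_weXz2l ?ler1n// lerN2.
Qed.

(** Opposite corners of the inner cube lie in the outer one; subtracting their first coordinates
    compares the side lengths. In dimension 0 all volumes are 1. *)
Lemma cube_subset_vol (R : realType) n (i j : int) (k k' : {ffun 'I_n -> int}) :
  @cube R n i k `<=` cube j k' -> cube_vol R n i <= cube_vol R n j.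
Proof.
move=> sub; rewrite /cube_vol; case: n k k' sub => [|n] k k' sub.
  by rewrite !expr0.
rewrite lerXn2r// ?nnegrE ?exprz_ge0//.
have i0 : 0 < 2 ^ (- i) :> R by rewrite exprz_gt0.
have corner c : 0 <= c <= 1 -> @cube R n.+1 i k (\row_m (2 ^ (- i) * ((k m)%:~R + c))).
  by move=> ? m; rewrite mxE intrD; nra.
have := sub _ (corner 0 _) ord0; have := sub _ (corner 1 _) ord0.
rewrite !mxE !intrD !lexx ler01 => /(_ isT) /andP[? ?] /(_ isT) /andP[? ?].
nra.
Qed.

(** * Monotonicity of the norms in the absolute values of the coefficients *)

Section Norms.
Context {R : realType} {n : nat}.
Variable alpha : R.
Implicit Types f g : Lam n -> R.

Lemma C_mono f f' j k : (forall l, `|f' l| <= `|f l|) ->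
  (C alpha f' j k <= C alpha f j k)%E.
Proof.
move=> le; rewrite /C lee_wpmul2l// ?lee_fin ?powR_ge0// lee_sqrt.
  apply: le_esum => l _; rewrite lee_fin ler_wpM2l// ?powR_ge0//.
  by rewrite lerXn2r ?nnegrE.
by apply: esum_ge0 => l _; rewrite lee_fin mulr_ge0// ?powR_ge0// exprn_ge0.
Qed.

Lemma C_le_norm f j k : (C alpha f j k <= Q0_norm alpha f)%E.
Proof. by apply: ereal_sup_ubound; exists (j, k). Qed.

Lemma Q0_norm_mono f f' : (forall l, `|f' l| <= `|f l|) ->
  (Q0_norm alpha f' <= Q0_norm alpha f)%E.
Proof.
move=> le; apply: ge_ereal_sup => _ [[j k] _ <-] /=.
exact: le_trans (C_mono _ _ le) (C_le_norm _ _ _).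
Qed.

Lemma Q0_ball_mono f f' : (forall l, `|f' l| <= `|f l|) ->
  Q0_ball alpha f -> Q0_ball alpha f'.
Proof.
move=> le [[fin small large] f1]; split; last first.
  by rewrite (le_trans (Q0_norm_mono le)).
split; first by rewrite (le_lt_trans (Q0_norm_mono le)).
- move=> e /small[d d0 H]; exists d => // j k /(H j k) Hjk.
  exact: le_lt_trans (C_mono _ _ le) Hjk.
- move=> e /large[M H]; exists M => j k /(H j k) Hjk.
  exact: le_lt_trans (C_mono _ _ le) Hjk.
Qed.

Lemma Q0_ball0 : Q0_ball alpha (0 : Lam n -> R).
Proof.
have C0 j k : C alpha (0 : Lam n -> R) j k = 0%E.
  by rewrite /C esum1 ?sqrte0 ?mule0// => l _; rewrite normr0 expr0n mulr0.
have N0 : (Q0_norm alpha (0%R : Lam n -> R) <= 0)%E.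
  by apply: ge_ereal_sup => _ [[j k] _ <-] /=; rewrite C0.
split; last by rewrite (le_trans N0)// lee01.
split.
- by rewrite (le_lt_trans N0)// ltry.
- by move=> e e0; exists 1 => // j k _; rewrite C0 lte_fin.
- by move=> e e0; exists 0 => j k _; rewrite C0 lte_fin.
Qed.

(** Multiplying [f] by the sign of [g] exchanges the pairings with [g] and with [|g|], so one
    substitution proves both inequalities. Where [g l = 0] the sign is 0, but the product vanishes
    there anyway. *)
Lemma P_norm_abs g : P_norm alpha (fun l => `|g l|) = P_norm alpha g.
Proof.
have sg_le f l : `|f l * Num.sg (g l)| <= `|f l|.
  by rewrite normrM normr_sg ler_piMr// lern1; case: eqP.
apply/eqP; rewrite eq_le; apply/andP; split;
    apply: ereal_sup_le => _ [f fB <-]; exists (fun l => f l * Num.sg (g l));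
    try exact: Q0_ball_mono (sg_le f) fB;
  congr (_%:E); apply: eq_tau => l; rewrite -mulrA.
- by rewrite mulrC -normrEsg mulrC.
- by rewrite mulr_sg_norm.
Qed.

Lemma P_norm_max f g : Q0_ball alpha f ->
  (forall f', Q0_ball alpha f' -> tau f' g <= tau f g) ->
  P_norm alpha g = (tau f g)%:E.
Proof.
move=> fB fmax; apply/eqP; rewrite eq_le; apply/andP; split.
  by apply: ge_ereal_sup => _ [f' f'B <-]; rewrite lee_fin fmax.
by apply: ereal_sup_ubound; exists f.
Qed.

End Norms.

(** * Sequences supported on a finite family of indices *)

Section FiniteSupport.
Context {R : realType} {n : nat} {I : finType}.
Variable nd : I -> Lam n.
Hypothesis nd_inj : injective nd.

(** Common form of [tree_fun] (with [nd] the map [node j k]) and of the one-scale sum in (iii) (with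
    [nd e = (e, j, k)]), so that both are instances by conversion. *)
Definition comb (v : I -> R) : Lam n -> R := \sum_i v i *: wavelet R (nd i).

Lemma comb_apply v l : comb v l = \sum_i v i * (l == nd i)%:R.
Proof. by rewrite /comb fct_sumE. Qed.

Lemma combE v i : comb v (nd i) = v i.
Proof.
rewrite comb_apply (bigD1 i)//= eqxx mulr1 big1 ?addr0// => i' ne.
by rewrite (inj_eq nd_inj) eq_sym (negPf ne) mulr0.
Qed.

Lemma comb_out v l : ~ range nd l -> comb v l = 0.
Proof.
move=> out; rewrite comb_apply big1// => i _.
by case: eqP => [e|]; [case: out; exists i | rewrite mulr0].
Qed.

(** Turns the extended sums in [tau], [C] and [pairing_summable] into finite real sums: terms off
    the range vanish, and injectivity of [nd] reindexes the rest by [I]. *)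
Lemma esum_finite_range (A : set (Lam n)) (F : Lam n -> R) :
  (forall l, 0 <= F l) -> (forall l, ~ range nd l -> F l = 0) ->
  \esum_(l in A) (F l)%:E = (\sum_(i | nd i \in A) F (nd i))%:E.
Proof.
move=> F0 Fout; rewrite esum_mkcond.
transitivity (\esum_(l in range nd) (if l \in A then (F l)%:E else 0%E)).
  rewrite [RHS]esum_mkcond; apply: eq_esum => l _.
  have [//|] := boolP (l \in range nd).
  by rewrite notin_setE => /Fout ->; case: ifP.
rewrite esum_image; last by move=> x y _ _; exact: nd_inj.
rewrite esum_fset; last 2 first.
  - exact: finite_finset.
  - by move=> i _; case: ifP => //; rewrite lee_fin.
rewrite -sumEFin.
have -> : [set: I] = [set` index_enum I].
  by apply/seteqP; split => // x _ /=; rewrite mem_index_enum.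
rewrite -fsbig_seq ?index_enum_uniq//.
by rewrite [RHS]big_mkcond.
Qed.

Lemma tau_comb f v : tau f (comb v) = \sum_i f (nd i) * v i.
Proof.
rewrite /tau !esum_finite_range.
- rewrite /= -sumrB; apply: eq_big => [i|i _]; first by rewrite in_setT.
  (* Positive part minus negative part gives back each term. *)
  by rewrite combE !maxr_absE !subr0 normrN; lra.
- by move=> l; rewrite le_max lexx orbT.
- by move=> l out; rewrite comb_out// mulr0 oppr0 maxxx.
- by move=> l; rewrite le_max lexx orbT.
- by move=> l out; rewrite comb_out// mulr0 maxxx.
Qed.

Lemma pairing_summable_comb f v : pairing_summable f (comb v).
Proof.
rewrite /pairing_summable /summable.
rewrite (@esum_finite_range _ (fun l => `|f l * comb v l|)) ?ltry//.
by move=> l out; rewrite comb_out// mulr0 normr0.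
Qed.

Lemma comb_restrict_le f l : `|comb (f \o nd) l| <= `|f l|.
Proof.
have [[i _ <-]|out] := pselect (range nd l); first by rewrite combE.
by rewrite comb_out// normr0.
Qed.

Definition wt (alpha : R) (i : I) : R := 2 `^ (2 * (scale (nd i))%:~R * alpha).

Lemma wt_gt0 alpha i : 0 < wt alpha i.
Proof. by rewrite powR_gt0. Qed.

Lemma C_comb alpha v j k : C alpha (comb v) j k =
  (cube_vol R n j `^ (alpha / n%:R - 2^-1) *
   Num.sqrt (\sum_(i | nd i \in
     [set l | @cube R n (scale l) (pos l) `<=` cube j k]) wt alpha i * v i ^+ 2))%:E.
Proof.
rewrite /C esum_finite_range.
- under eq_bigr do rewrite combE real_normK ?num_real//.
  by rewrite EFinM.
- by move=> l; rewrite mulr_ge0// ?powR_ge0// exprn_ge0.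
- by move=> l out; rewrite comb_out// normr0 expr0n mulr0.
Qed.

End FiniteSupport.

Lemma lt0_ltr_powR (R : realType) (b x y : R) :
  b < 0 -> 0 < x -> x < y -> y `^ b < x `^ b.
Proof.
move=> b0 x0 xy; have y0 := lt_trans x0 xy.
rewrite -[b]opprK (powRN x) (powRN y) ltf_pV2 ?posrE ?powR_gt0//.
by apply: gt0_ltr_powR; rewrite ?oppr_gt0// nnegrE ltW.
Qed.

Lemma lt0_ler_powR (R : realType) (b x y : R) :
  b < 0 -> 0 < x -> x <= y -> y `^ b <= x `^ b.
Proof.
move=> b0 x0; rewrite le_eqVlt => /predU1P[->//|xy].
exact/ltW/lt0_ltr_powR.
Qed.

(** * Finitely supported sequences belong to [Q0] *)

Section Maximizer.
Import numFieldNormedType.Exports.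
Context {R : realType} {n : nat} {I : finType}.
Variable nd : I -> Lam n.
Hypothesis nd_inj : injective nd.
Variable alpha : R.
Hypothesis alpha_gt0 : 0 < alpha.
Hypothesis alpha_lt : alpha < n%:R / 2.

Let b := alpha / n%:R - 2^-1.
Let energy (v : I -> R) := \sum_i wt nd alpha i * v i ^+ 2.
Let sub j k i := nd i \in [set l | @cube R n (scale l) (pos l) `<=` cube j k].
Let Cr j k (v : I -> R) :=
  cube_vol R n j `^ b * Num.sqrt (\sum_(i | sub j k i) wt nd alpha i * v i ^+ 2).

Let CrE v j k : C alpha (comb nd v) j k = (Cr j k v)%:E.
Proof. by rewrite C_comb. Qed.

Let b_lt0 : b < 0.
Proof.
have n0 : 0 < n%:R :> R by have := lt_trans alpha_gt0 alpha_lt; rewrite pmulr_lgt0.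
by rewrite /b subr_lt0 ltr_pdivrMr// mulrC.
Qed.

Let term_ge0 (v : I -> R) i : 0 <= wt nd alpha i * v i ^+ 2.
Proof. by rewrite mulr_ge0 ?sqr_ge0// ltW// wt_gt0. Qed.

(** Extending the sum to the whole support leaves the cube present only through its volume factor,
    which decays because [b < 0]. *)
Lemma C_comb_le v j k :
  (C alpha (comb nd v) j k <= (cube_vol R n j `^ b * Num.sqrt (energy v))%:E)%E.
Proof.
rewrite CrE lee_fin ler_wpM2l ?powR_ge0// ler_wsqrtr//.
rewrite /energy [leRHS](bigID (sub j k)) /= lerDl.
by apply: sumr_ge0 => i _; exact: term_ge0.
Qed.

(** A cube smaller than every cube of the support contains none of them, so its sum is empty. *)
Lemma C_comb_small : exists2 d : R, 0 < d &
  forall v j k, cube_vol R n j < d -> C alpha (comb nd v) j k = 0%E.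
Proof.
(* A crude upper bound for all the scales in the support. *)
pose J : int := \sum_i `|scale (nd i)|.
have leJ i : scale (nd i) <= J.
  rewrite (le_trans (ler_norm _))// /J (bigD1 i)//= lerDl.
  by apply: sumr_ge0.
exists (cube_vol R n J) => [|v j k small]; first exact: cube_vol_gt0.
rewrite CrE /Cr big1 ?sqrtr0 ?mulr0// => i.
rewrite /sub in_setE /= => /cube_subset_vol le_j.
by have := le_lt_trans le_j small; rewrite ltNge cube_vol_anti.
Qed.

Lemma Q0_norm_comb : exists2 B : R, 0 < B &
  forall v, (Q0_norm alpha (comb nd v) <= (B * Num.sqrt (energy v))%:E)%E.
Proof.
have [d d0 small] := C_comb_small.
exists (d `^ b) => [|v]; first exact: powR_gt0.
apply: ge_ereal_sup => _ [[j k] _ <-] /=.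
have [lt_d|ge_d] := ltP (cube_vol R n j) d.
  by rewrite small// lee_fin mulr_ge0 ?powR_ge0 ?sqrtr_ge0.
rewrite (le_trans (C_comb_le _ _ _))// lee_fin ler_wpM2r ?sqrtr_ge0//.
exact: lt0_ler_powR.
Qed.

Lemma Q0_comb v : Q0 alpha (comb nd v).
Proof.
have [B _ HB] := Q0_norm_comb; have [d d0 small] := C_comb_small.
split; first exact: le_lt_trans (HB v) (ltry _).
- by move=> e e0; exists d => // j k jd; rewrite small// lte_fin.
move=> e e0; set K := Num.sqrt (energy v); have K0 : 0 <= K by exact: sqrtr_ge0.
have y0 : 0 < e / (K + 1) by rewrite divr_gt0// ltr_wpDl.
exists ((e / (K + 1)) `^ b^-1) => j k big_j.
rewrite (le_lt_trans (C_comb_le _ _ _))// lte_fin -/K.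
have : cube_vol R n j `^ b < e / (K + 1).
  have -> : e / (K + 1) = ((e / (K + 1)) `^ b^-1) `^ b.
    by rewrite -powRrM mulVf ?ltr0_neq0// powRr1// ltW.
  by rewrite lt0_ltr_powR// powR_gt0.
rewrite ltr_pdivlMr ?ltr_wpDl//; have := powR_ge0 (cube_vol R n j) b; nra.
Qed.

(** Since [comb nd v] always lies in [Q0], only the norm bound remains; this displays the ball as an
    intersection of sublevel sets of the continuous functions [Cr j k]. *)
Let ballE v : Q0_ball alpha (comb nd v) <-> forall q, Cr q.1 q.2 v <= 1.
Proof.
split=> [[_ v1] [j k]|v1].
  by rewrite -lee_fin -CrE (le_trans (C_le_norm _ _ _ _)).
split; first exact: Q0_comb.
by apply: ge_ereal_sup => _ [q _ <-]; rewrite CrE lee_fin.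
Qed.

(** * Compactness of the ball in the product topology, and maximizers *)

Import ArrowAsProduct.

Let coord_continuous i : continuous (fun v : I -> R => v i).
Proof. exact: (@proj_continuous I (fun=> R) i). Qed.

Let Cr_continuous j k : continuous (Cr j k).
Proof.
pose S (v : I -> R) := \sum_(i | sub j k i) wt nd alpha i * v i ^+ 2.
have cS : continuous S.
  apply: (@continuous_big R I +%R 0 (sub j k)); first exact: add_continuous.
  move=> i _ v.
  apply: (@continuous_comp _ _ _ (fun v : I -> R => v i)
    (fun y : R => wt nd alpha i * y ^+ 2) v); first exact: coord_continuous.
  apply: (@continuous_comp _ _ _ (fun y : R => y ^+ 2) ( *%R (wt nd alpha i))).
    exact: exprn_continuous.
  exact: mulrl_continuous.
move=> v; apply: (@continuous_comp _ _ _ (fun v => Num.sqrt (S v))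
  ( *%R (cube_vol R n j `^ b)) v); last exact: mulrl_continuous.
by apply: (@continuous_comp _ _ _ S (@Num.sqrt R) v);
  [exact: cS|exact: sqrt_continuous].
Qed.

(** Test the ball condition on the cube of [nd i] itself and keep only the term of index [i]. *)
Let coord_bound (v : I -> R) i : Q0_ball alpha (comb nd v) ->
  `|v i| <= (cube_vol R n (scale (nd i)) `^ b * Num.sqrt (wt nd alpha i))^-1.
Proof.
move=> /ballE/(_ (scale (nd i), pos (nd i))); apply: contra_le => lt.
rewrite /Cr (lt_le_trans (y := cube_vol R n (scale (nd i)) `^ b *
   Num.sqrt (wt nd alpha i * v i ^+ 2)))//.
  rewrite sqrtrM ?ltW ?wt_gt0// sqrtr_sqr mulrA -ltr_pdivrMl ?mulr1//.
  by rewrite mulr_gt0 ?powR_gt0 ?cube_vol_gt0// sqrtr_gt0 wt_gt0.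
rewrite ler_wpM2l ?powR_ge0// ler_wsqrtr// (bigD1 i)/= ?lerDl ?sumr_ge0//.
by rewrite /sub inE /=.
Qed.

(** The admissible [v] form a closed subset of a product of segments, compact by Tychonoff, on which
    a linear form attains its maximum. Restriction to the support extends the bound to every [f] in
    the ball. *)
Lemma comb_maximizer (c : I -> R) : exists2 v, Q0_ball alpha (comb nd v) &
  forall f, Q0_ball alpha f -> tau f (comb nd c) <= \sum_i v i * c i.
Proof.
pose A : set (I -> R) := [set v | Q0_ball alpha (comb nd v)].
pose box i : set R := let r := (cube_vol R n (scale (nd i)) `^ b *
  Num.sqrt (wt nd alpha i))^-1 in `[- r, r]%classic.
have closedA : closed A.
  have -> : A = \bigcap_q (Cr q.1 q.2 @^-1` [set x | x <= 1]).
    by apply/seteqP; split=> v; [move/ballE => H q _; exact: H|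
      move=> H; apply/ballE => q; exact: H].
  apply: closed_bigI => q _; apply: preimage_closed; last exact: closed_le.
  by move=> v _; exact: Cr_continuous.
have compactA : compact A.
  apply: (subclosed_compact closedA (@tychonoff I (fun=> R) box _)).
    by move=> i; exact: segment_compact.
  by move=> v Av i; rewrite /box /= in_itv/= -ler_norml coord_bound.
have A0 : A !=set0.
  exists (fun=> 0); rewrite /A /=.
  have -> : comb nd (fun=> 0 : R) = 0.
    by rewrite /comb big1// => i _; rewrite scale0r.
  exact: Q0_ball0.
have [|v /set_mem Av vmax] := @compact_EVT_max _ _
    (fun v : I -> R => \sum_i v i * c i) A A0 compactA.
  apply: continuous_subspaceT.
  apply: (@continuous_big R I +%R 0 predT); first exact: add_continuous.
  move=> i _ u; apply: (@continuous_comp _ _ _ (fun u : I -> R => u i)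
    ( *%R^~ (c i)) u); first exact: coord_continuous.
  exact: mulrr_continuous.
exists v => // f fB; rewrite tau_comb//; apply: vmax; apply/mem_set.
exact: Q0_ball_mono (comb_restrict_le nd_inj f) fB.
Qed.

(** A small multiple of a single wavelet lies in the ball; this makes the norm of that wavelet in
    [P_norm] positive, so that it can be divided by. *)
Lemma comb_ball_pos i0 : exists2 e : R, 0 < e &
  Q0_ball alpha (comb nd (fun i => e * (i == i0)%:R)).
Proof.
have [B B0 HB] := Q0_norm_comb; set s := Num.sqrt (wt nd alpha i0).
have s0 : 0 < s by rewrite sqrtr_gt0 wt_gt0.
exists (B * s)^-1; first by rewrite invr_gt0 mulr_gt0.
split; first exact: Q0_comb.
rewrite (le_trans (HB _))// lee_fin /energy (bigD1 i0)//= big1 ?addr0.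
  rewrite eqxx mulr1 sqrtrM ?(ltW (wt_gt0 _ _ _))// sqrtr_sqr ger0_norm.
    by rewrite mulrA mulfV// gt_eqF// mulr_gt0.
  by rewrite invr_ge0 mulr_ge0// ltW.
by move=> i /negPf ->; rewrite mulr0 expr0n mulr0.
Qed.

End Maximizer.

(** * The tree of nodes and the three assertions *)

Lemma node_inj t n j k : injective (@node t n j k).
Proof.
move=> [e [s u]] [e' [s' u']] [/= -> /addrI[] /val_inj es]; subst s'.
move=> /ffunP H; congr (_, Tagged _ _); apply/ffunP => i.
by have := H i; rewrite !ffunE => /addrI[] /val_inj.
Qed.

Unset Implicit Arguments.

Theorem theorem3p4 (R : realType) (n : nat) (alpha : R)
    (alpha_gt0 : 0 < alpha) (alpha_lt : alpha < n%:R / 2) (t : nat) (j : int) :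
  exists P : (Lam n -> R) -> R,
  forall (k : {ffun 'I_n -> int}) (coef : Lam n -> R),
  let g : Lam n -> R := tree_fun t j k coef in
  (0 < P_norm alpha g)%E ->
  (exists S : Lam n -> R,
     let Sf : Lam n -> R := tree_fun t j k S in
     [/\ Q0 alpha Sf,
         (Q0_norm alpha Sf <= 1)%E,
         is_max [set tau f g | f in Q0_ball alpha]
           (\sum_(x : G t n) S (node j k x) * coef (node j k x))
       & let p : R := P (fun l => `|g l|) in
         [/\ 0 < p,
             p%:E = P_norm alpha g,
             is_max [set tau f g | f in Q0_ball alpha] p
           & p = tau Sf g]]) /\
  (exists Q : E n -> R,
     let h : Lam n -> R := \sum_(e : E n) Q e *: wavelet R (e, j, k) in
     P_space alpha h /\ P_norm alpha h = P_norm alpha g).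
Proof.
(* This functional receives only [|g|]; [P_norm_abs] identifies its value with the norm of [g]. *)
exists (fun a => fine (P_norm alpha a)) => k coef g Pg_gt0.
have ndI := @node_inj t n j k.
pose nd := @node t n j k.
have gE : g = comb nd (coef \o nd) by [].
have [v vB vmax] := comb_maximizer ndI alpha_gt0 alpha_lt (coef \o nd).
have taug : tau (comb nd v) g = \sum_x v x * coef (nd x).
  by rewrite gE tau_comb//; apply: eq_bigr => x _; rewrite combE.
have Pg : P_norm alpha g = (\sum_x v x * coef (nd x))%:E.
  by rewrite -taug; apply: P_norm_max => // f fB; rewrite taug gE vmax.
have p_gt0 : 0 < \sum_x v x * coef (nd x) by rewrite -lte_fin -Pg.
have maxp : is_max [set tau f g | f in Q0_ball alpha] (\sum_x v x * coef (nd x)).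
  split; first by exists (comb nd v).
  by move=> _ [f fB <-]; rewrite gE vmax.
split.
  exists (comb nd v) => Sf.
  have SfE : Sf = comb nd v.
    by rewrite /Sf /tree_fun; apply: eq_bigr => x _; rewrite combE.
  have -> : \sum_x comb nd v (nd x) * coef (nd x) = \sum_x v x * coef (nd x).
    by apply: eq_bigr => x _; rewrite combE.
  by rewrite P_norm_abs Pg SfE taug; case: vB => vQ v1; split.
have n_gt0 : (0 < n)%N.
  by rewrite -(ltr0n R); have := lt_trans alpha_gt0 alpha_lt; rewrite pmulr_lgt0.
(* The all-ones vector is nonzero because [n] is positive; it selects the single wavelet used for
   (iii). *)
have e0P : [ffun=> true] != [ffun=> false] :> {ffun 'I_n -> bool}.
  by apply/eqP => /ffunP/(_ (Ordinal n_gt0)); rewrite !ffunE.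
pose e0 : E n := exist _ [ffun=> true] e0P.
pose top (e : E n) : Lam n := (e, j, k).
have topI : injective top by move=> e e' [].
pose delta (e : E n) : R := (e == e0)%:R.
have delta_sum (u : E n -> R) (a : R) : \sum_e u e * (a * delta e) = a * u e0.
  rewrite (bigD1 e0)//= big1 ?addr0 /delta ?eqxx ?mulr1 1?mulrC//.
  by move=> e /negPf ->; rewrite !mulr0.
(* The maximal pairing with the wavelet at [e0] is [w e0], which is therefore its norm. *)
have [w wB wmax] := comb_maximizer topI alpha_gt0 alpha_lt delta.
have delta_sum1 (u : E n -> R) : \sum_e u e * delta e = u e0.
  by rewrite -[RHS]mul1r -delta_sum; apply: eq_bigr => e _; rewrite mul1r.
have w_gt0 : 0 < w e0.
  have [e e_gt0 eB] := comb_ball_pos topI alpha_gt0 alpha_lt e0.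
  move/wmax: eB; rewrite tau_comb// !delta_sum1 combE// eqxx mulr1.
  exact: lt_le_trans.
(* The norm of [g] divided by that of the wavelet at [e0]; by homogeneity [a] times this wavelet has
   the norm of [g]. *)
pose a := (\sum_x v x * coef (nd x)) / w e0.
have a_ge0 : 0 <= a by rewrite divr_ge0// ltW.
exists (fun e => a * delta e) => h.
have hE : h = comb top (fun e => a * delta e) by [].
have tauh f : tau f h = a * tau f (comb top delta).
  by rewrite hE !tau_comb// delta_sum delta_sum1.
have Ph : P_norm alpha h = P_norm alpha g.
  rewrite (P_norm_max wB); last first.
    move=> f fB; rewrite !tauh ler_wpM2l//.
    rewrite (le_trans (wmax _ fB))// tau_comb//.
    by under [leRHS]eq_bigr do rewrite combE//.
  by rewrite tauh tau_comb// delta_sum1 combE// /a divfK ?gt_eqF// Pg.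
split=> //; split; first by move=> f _; rewrite hE; exact: pairing_summable_comb.
by rewrite Ph Pg ltry.
Qed.
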